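(* Let $\varphi\colon\mathbb{R}^n\to\overline{\mathbb{R}}$ be a lower semicontinuous function, and fix $\bar x\in\mathbb{R}^n$ such that $|\varphi(\bar x)|<\infty$. Then the following assertions hold. (a) Pick $u\in\mathcal{C}_\varphi(\bar x)\cap\mathbb{S}$. If $\bar x$ is a local minimizer of $\varphi$ in direction $u$, then $\mathrm{d}^2\varphi(\bar x;0)(u)\ge0$. (b) If $\bar x$ is a local minimizer of $\varphi$, then $\mathrm{d}^2\varphi(\bar x;0)(u)\ge0$ for each $u\in\mathcal{C}_\varphi(\bar x)\cap\mathbb{S}$.
   Context: $\overline{\mathbb{R}}:=\mathbb{R}\cup\{-\infty,\infty\}$; $\mathbb{R}^n$ carries the Euclidean norm $\|\cdot\|$ and inner product $\langle\cdot,\cdot\rangle$; $\mathbb{S}:=\{u\in\mathbb{R}^n : \|u\|=1\}$. Directional neighborhoods: for $\varepsilon,\rho>0$ and $u\in\mathbb{R}^n$, $\mathbb{B}_{\varepsilon,\rho}(u):=\{w\in\mathbb{R}^n : \|w\|\le\varepsilon,\ \big\|\|w\|u-\|u\|w\big\|\le\rho\|u\|\|w\|\}$. Directional local minimality: $\bar x$ (with $|\varphi(\bar x)|<\infty$) is a local minimizer of $\varphi$ in direction $u$ if there are $\varepsilon,\rho>0$ with $\varphi(x)\ge\varphi(\bar x)$ for all $x\in\bar x+\mathbb{B}_{\varepsilon,\rho}(u)$. A local minimizer is meant in the usual sense (equivalently, $u=0$). First subderivative: $\mathrm{d}\varphi(\bar x)(u):=\liminf_{t\downarrow0,\,u'\to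 u}\frac{\varphi(\bar x+tu')-\varphi(\bar x)}{t}$. Critical cone: $\mathcal{C}_\varphi(\bar x):=\{u\in\mathbb{R}^n : \mathrm{d}\varphi(\bar x)(u)\le0\}$. Second subderivative at $\bar x$ for $x^*\in\mathbb{R}^n$: $\mathrm{d}^2\varphi(\bar x;x^* )(u):=\liminf_{t\downarrow0,\,u'\to u}\frac{\varphi(\bar x+tu')-\varphi(\bar x)-t\langle x^*,u'\rangle}{\frac12t^2}$. *)

(* Defs.v *)
From HB Require Import structures.
From mathcomp Require Import all_boot all_order all_algebra.
From mathcomp Require Import all_classical all_reals.
From mathcomp Require Import topology normedtype.

Set Implicit Arguments.
Unset Strict Implicit.
Unset Printing Implicit Defensive.

Import Order.TTheory GRing.Theory Num.Theory.
Import numFieldNormedType.Exports.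

Local Open Scope classical_set_scope.
Local Open Scope ring_scope.

Section VariationalDefs.
Context {R : realType} {n : nat}.
Implicit Types (phi : 'rV[R]_n -> \bar R) (x u v w xs : 'rV[R]_n).

Definition dotv u v : R := \sum_(i < n) u ord0 i * v ord0 i.

(* The library norm `|u| on 'rV[R]_n is the sup norm, so the Euclidean norm is
   defined here; both induce the canonical topology used for nbhs below. *)
Definition enorm u : R := Num.sqrt (dotv u u).

Definition esphere : set 'rV[R]_n := [set u | enorm u = 1].

Definition dir_nbhd (e r : R) u : set 'rV[R]_n :=
  [set w | enorm w <= e /\
           enorm (enorm w *: u - enorm u *: w) <= r * enorm u * enorm w].

Definition dir_local_minimizer phi x u : Prop :=
  exists e r : R, [/\ 0 < e, 0 < r &
    forall w, dir_nbhd e r u w -> (phi x <= phi (x + w)%R)%E].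

Definition local_minimizer phi x : Prop :=
  \forall y \near x, (phi x <= phi y)%E.

(* The subderivatives are meant at points x with phi x finite, so that the
   subtractions in \bar R are unambiguous. *)
Definition subderivative phi x u : \bar R :=
  limf_einf (fun p : R * 'rV[R]_n =>
      ((phi (x + p.1 *: p.2)%R - phi x) / p.1%:E)%E)
    (filter_prod 0^'+ (nbhs u)).

Definition critical_cone phi x : set 'rV[R]_n :=
  [set u | (subderivative phi x u <= 0)%E].

Definition second_subderivative phi x xs u : \bar R :=
  limf_einf (fun p : R * 'rV[R]_n =>
      ((phi (x + p.1 *: p.2)%R - phi x - (p.1 * dotv xs p.2)%:E)
         / (2^-1 * p.1 ^+ 2)%:E)%E)
    (filter_prod 0^'+ (nbhs u)).

End VariationalDefs.

(* Main.v *)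
Require Import Defs.
From HB Require Import structures.
From mathcomp Require Import all_boot all_order all_algebra.
From mathcomp Require Import all_classical all_reals.
From mathcomp Require Import topology normedtype.
From mathcomp Require Import ereal realfun.
Import Order.TTheory GRing.Theory Num.Theory.
Import numFieldNormedType.Exports.
Local Open Scope classical_set_scope.
Local Open Scope ring_scope.

(** If the increments [phi (x + t u') - phi x] are nonnegative for all small
    [t > 0] and all [u'] close to [u], then so are the second-order difference
    quotients for [x^* = 0], hence so is their lower limit.  Local minimality
    gives this because [x + t u' --> x].  Directional local minimality gives
    it because [t u'] lies in every directional neighborhood of a nonzero [u]
    for such [t] and [u']: the angular condition defining the neighborhood is
    homogeneous in [w], so for [w = t u'] it is a condition on [u'] alone; at
    [u' = u] it is the strict inequality [0 < r * enorm u ^ 2], which persists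
    near [u] by continuity of the Euclidean norm. *)

Lemma limf_einf_ge0 (R : realType) (T : choiceType) (X : filteredType T)
    (f : X -> \bar R) (F : set_system X) :
  (\forall p \near F, (0 <= f p)%E) -> (0 <= limf_einf f F)%E.
Proof.
move=> Ff; rewrite limf_einfE.
apply: (@le_trans _ _ (ereal_inf (f @` [set p | (0 <= f p)%E]))).
  by apply: le_ereal_inf_tmp => _ [p fp <-].
by apply: ereal_sup_ubound; exists [set p | (0 <= f p)%E].
Qed.

Section EuclideanNorm.
Context {R : realType} {n : nat}.
Implicit Types u w : 'rV[R]_n.

Lemma dot0v w : dotv 0 w = 0 :> R.
Proof. by rewrite /dotv big1 // => i _; rewrite mxE mul0r. Qed.

Lemma enorm0 : enorm (0 : 'rV[R]_n) = 0.
Proof. by rewrite /enorm dot0v sqrtr0. Qed.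

Lemma enormZ (a : R) w : 0 <= a -> enorm (a *: w) = a * enorm w.
Proof.
move=> a0; rewrite /enorm -[in RHS](ger0_norm a0) -sqrtr_sqr -sqrtrM ?sqr_ge0//.
congr Num.sqrt; rewrite /dotv mulr_sumr; apply: eq_bigr => i _.
by rewrite !mxE mulrACA expr2.
Qed.

Lemma enorm_continuous : continuous (enorm : 'rV[R]_n -> R).
Proof.
move=> u; apply: (@continuous_comp _ _ _ (fun v => dotv v v) (@Num.sqrt R)).
  apply: continuous_big => [|i _ v]; first exact: add_continuous.
  by apply: (@cvgM _ _ (nbhs v)); exact: coord_continuous.
exact: sqrt_continuous.
Qed.

End EuclideanNorm.

(* For row vectors [nbhs u] is elaborated through the filtered structure of
   matrices, on which the instance for topological spaces is not found. *)
#[local] Instance nbhs_row_filter (R : realType) (n : nat) (u : 'rV[R]_n) :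
  ProperFilter (nbhs u) := nbhs_pfilter u.

Section SecondSubderivative.
Context {R : realType} {n : nat}.
Implicit Types (phi : 'rV[R]_n -> \bar R) (x u : 'rV[R]_n).

Lemma second_subderivative0_ge0 phi x u : phi x \is a fin_num ->
  (\forall p \near filter_prod 0^'+ (nbhs u),
     (phi x <= phi (x + p.1 *: p.2)%R)%E) ->
  (0 <= second_subderivative phi x 0 u)%E.
Proof.
move=> phix phi_ge; apply: limf_einf_ge0.
apply: filterS phi_ge => p phi_le.
rewrite dot0v mulr0 sube0 mule_ge0 ?inve_ge0 ?lee_fin ?suber_ge0//.
by rewrite mulr_ge0 ?invr_ge0 ?sqr_ge0.
Qed.

Lemma cvg_scale_right0 u :
  p.1 *: p.2 @[p --> filter_prod (0 : R)^'+ (nbhs u)] --> (0 : 'rV[R]_n).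
Proof.
rewrite -(scale0r u); apply: cvgZ; last exact: cvg_snd.
by apply: cvg_trans; [exact: cvg_fst | exact: cvg_within].
Qed.

Lemma local_minimizer_near phi x u : local_minimizer phi x ->
  \forall p \near filter_prod 0^'+ (nbhs u),
    (phi x <= phi (x + p.1 *: p.2)%R)%E.
Proof.
have : x + p.1 *: p.2 @[p --> filter_prod (0 : R)^'+ (nbhs u)] --> x.
  rewrite -[X in _ --> X]addr0.
  by apply: cvgD (cvg_scale_right0 u); exact: cvg_cst.
exact.
Qed.

(** Dividing the angular condition on [t *: v] by [t > 0] leaves a condition on
    [v] between continuous functions, which is strict at [v = u]. *)
Lemma dir_nbhd_near (e r : R) u : 0 < e -> 0 < r -> 0 < enorm u ->
  \forall p \near filter_prod 0^'+ (nbhs u), dir_nbhd e r u (p.1 *: p.2).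
Proof.
move=> e0 r0 u0.
have small : \forall p \near filter_prod 0^'+ (nbhs u),
    enorm (p.1 *: p.2) < e.
  have : enorm (p.1 *: p.2) @[p --> filter_prod (0 : R)^'+ (nbhs u)] --> (0 : R).
    rewrite -[X in _ --> X](@enorm0 R n).
    apply: (cvg_comp (fun p => p.1 *: p.2)); first exact: cvg_scale_right0.
    exact: enorm_continuous.
  by move/cvgr_lt; exact.
have angle : \forall v \near u,
    enorm (enorm v *: u - enorm u *: v) < r * enorm u * enorm v.
  pose gap v := r * enorm u * enorm v - enorm (enorm v *: u - enorm u *: v).
  have : gap v @[v --> u] --> gap u.
    have cvg_enorm : enorm v @[v --> u] --> enorm u by exact: enorm_continuous.
    have cvg_cross : enorm v *: u - enorm u *: v @[v --> u] -->
        enorm u *: u - enorm u *: u.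
      exact: cvgB (cvgZ cvg_enorm (cvg_cst u)) (cvgZ (cvg_cst _) cvg_id).
    rewrite /gap; apply: cvgB; first exact: cvgM (cvg_cst _) cvg_enorm.
    exact: (cvg_comp _ _ cvg_cross (@enorm_continuous R n _)).
  have gapu : 0 < gap u by rewrite /gap subrr enorm0 subr0 !mulr_gt0.
  move=> /cvgr_gt/(_ _ gapu); apply: filterS => v.
  by rewrite subr_gt0.
have t_pos : \forall p \near filter_prod (0 : R)^'+ (nbhs u), 0 < p.1.
  exact: (@cvg_fst R 'rV[R]_n 0^'+ (nbhs u) _ _ (nbhs_right_gt _)).
have v_angle : \forall p \near filter_prod (0 : R)^'+ (nbhs u),
    enorm (enorm p.2 *: u - enorm u *: p.2) < r * enorm u * enorm p.2.
  exact: (@cvg_snd R 'rV[R]_n 0^'+ (nbhs u) _ _ angle).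
apply: filterS3 small t_pos v_angle => -[t v] /= tv_small t0 v_angle.
have t_ge0 := ltW t0; split; first exact: ltW.
have -> : enorm (t *: v) *: u - enorm u *: (t *: v) =
          t *: (enorm v *: u - enorm u *: v).
  by rewrite enormZ // scalerBr !scalerA (mulrC (enorm u)).
by rewrite !enormZ // mulrCA ler_pM2l// ltW.
Qed.

End SecondSubderivative.

Theorem proposition3p12 (R : realType) (n : nat)
    (phi : 'rV[R]_n -> \bar R) (xbar : 'rV[R]_n) :
  lower_semicontinuous phi ->
  phi xbar \is a fin_num ->
  (forall u : 'rV[R]_n, (critical_cone phi xbar `&` esphere) u ->
     dir_local_minimizer phi xbar u ->
     (0 <= second_subderivative phi xbar 0 u)%E) /\
  (local_minimizer phi xbar ->
     forall u : 'rV[R]_n, (critical_cone phi xbar `&` esphere) u ->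
       (0 <= second_subderivative phi xbar 0 u)%E).
Proof.
move=> _ phix; split=> [u [_ u1] [e [r [e0 r0 phi_min]]]|phi_min u _].
  apply: second_subderivative0_ge0 => //.
  have u_gt0 : 0 < enorm u by rewrite u1 ltr01.
  by apply: filterS (dir_nbhd_near _ _ _ e0 r0 u_gt0) => p; exact: phi_min.
apply: second_subderivative0_ge0 => //.
exact: local_minimizer_near.
Qed.
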